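(* Let $(X,\widehat{d}_X)$ and $(Y,\widehat{d}_Y)$ be two non-Archimedean metric spaces. Then $$\widehat{d}_{GH}(X,Y)=\inf\{\varepsilon>0 : \text{there exists a strong } \varepsilon\text{-isometry from } X \text{ to } Y\}.$$
   Context: A non-Archimedean metric space $(X,\widehat{d}_X)$ is a set with a metric satisfying the strong triangle inequality $\widehat{d}_X(x,z)\le\max\{\widehat{d}_X(x,y),\widehat{d}_X(y,z)\}$. The non-Archimedean Gromov-Hausdorff distance is $\widehat{d}_{GH}(X,Y)=\inf\{\widehat{d}_{H}(f(X),g(Y))\}$, the infimum being over all non-Archimedean metric spaces $(Z,\widehat{d}_Z)$ and all isometric embeddings $f:X\hookrightarrow Z$, $g:Y\hookrightarrow Z$, where $\widehat{d}_H$ is the Hausdorff distance between subsets of $Z$ (it may be $\infty$). The infimum of the empty set is $+\infty$. A subset $S$ of a metric space $(Y,d)$ is an $\varepsilon$-net if $\operatorname{dist}(y,S)=\inf_{s\in S}d(y,s)<\varepsilon$ for all $y\in Y$. For a map $f:X\to Y$, $\operatorname{dis}f=\sup_{x_1,x_2\in X}|\widehat{d}_Y(f(x_1),f(x_2))-\widehat{d}_X(x_1,x_2)|$. A (possibly non-continuous) map $f:X\to Y$ is an $\varepsilon$-isometry if $\operatorname{dis}f<\varepsilon$ and $f(X)$ is an $\varepsilon$-net in $Y$. An $\varepsilon$-isometry $f:X\to Y$ is a strong $\varepsilon$-isometry if it satisfies both of the following. ($SI_1$) For $x\in X$ and $y\in Y$, if $\widehat{d}_Y(y,f(x))\ge\varepsilon$,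 then there exists $x'\in X$ such that $\widehat{d}_Y(y,f(x'))<\varepsilon$ and $\widehat{d}_X(x,x')=\widehat{d}_Y(y,f(x))$. ($SI_2$) For $x_1,x_2\in X$, if $\widehat{d}_X(x_1,x_2)\ne\widehat{d}_Y(f(x_1),f(x_2))$, then $\widehat{d}_X(x_1,x_2)<\varepsilon$. *)

(* Defs.v *)
From mathcomp Require Import all_boot all_order all_algebra.
From mathcomp Require Import all_classical all_reals all_analysis.

Set Implicit Arguments.
Unset Strict Implicit.
Unset Printing Implicit Defensive.

Import Order.TTheory GRing.Theory Num.Theory.

Local Open Scope classical_set_scope.
Local Open Scope ring_scope.

Definition non_archimedean (R : realType) (X : metricType R) : Prop :=
  forall x y z : X, mdist x z <= Num.max (mdist x y) (mdist y z).

(* Equal to +oo when S is empty. *)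
Definition dist_set (R : realType) (X : metricType R) (x : X) (S : set X) :
    \bar R :=
  ereal_inf [set (mdist x s)%:E | s in S].

Definition neighborhood (R : realType) (X : metricType R) (r : R) (S : set X) :
    set X :=
  [set x | (dist_set x S < r%:E)%E].

Definition hausdorff_dist (R : realType) (X : metricType R) (A B : set X) :
    \bar R :=
  ereal_inf [set r%:E | r in
    [set r : R | [/\ 0 < r, A `<=` neighborhood r B & B `<=` neighborhood r A]]].

Definition isometric (R : realType) (X Y : metricType R) (f : X -> Y) : Prop :=
  forall x1 x2 : X, mdist (f x1) (f x2) = mdist x1 x2.

Definition na_gromov_hausdorff (R : realType) (X Y : metricType R) : \bar R :=
  ereal_inf [set d : \bar R |
    exists (Z : metricType R) (f : X -> Z) (g : Y -> Z),
      [/\ non_archimedean Z, isometric f, isometric g &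
          d = hausdorff_dist (range f) (range g)]].

Definition is_net (R : realType) (Y : metricType R) (eps : R) (S : set Y) :
    Prop :=
  forall y : Y, (dist_set y S < eps%:E)%E.

(* For empty X this is -oo rather than 0; both are below every eps > 0, so the
   notion of eps-isometry is not affected. *)
Definition distortion (R : realType) (X Y : metricType R) (f : X -> Y) :
    \bar R :=
  ereal_sup [set `|mdist (f p.1) (f p.2) - mdist p.1 p.2|%:E
            | p in [set: X * X]].

Definition eps_isometry (R : realType) (X Y : metricType R) (eps : R)
    (f : X -> Y) : Prop :=
  (distortion f < eps%:E)%E /\ is_net eps (range f).

Definition SI1 (R : realType) (X Y : metricType R) (eps : R) (f : X -> Y) :
    Prop :=
  forall (x : X) (y : Y), eps <= mdist y (f x) ->
    exists x' : X, mdist y (f x') < eps /\ mdist x x' = mdist y (f x).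

Definition SI2 (R : realType) (X Y : metricType R) (eps : R) (f : X -> Y) :
    Prop :=
  forall x1 x2 : X, mdist x1 x2 <> mdist (f x1) (f x2) -> mdist x1 x2 < eps.

Definition strong_eps_isometry (R : realType) (X Y : metricType R) (eps : R)
    (f : X -> Y) : Prop :=
  [/\ eps_isometry eps f, SI1 eps f & SI2 eps f].

(* Main.v *)
(** If [f] is a strong [eps]-isometry then, by [SI1] and [SI2], the distances
    [d(x1, x2)] and [d(f x1, f x2)] coincide up to replacing values below [eps]
    by [eps]. Hence [d(x, y) = max(eps, d(f x, y))] extends the metrics of [X]
    and [Y] to an ultrametric on [X + Y], where the Hausdorff distance of [X]
    and [Y] is at most [eps]. Conversely, if [X] and [Y] lie in an ultrametric
    space and each is within [r] of the other, then any map moving points by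
    less than [r] is a strong [eps]-isometry for every [eps > r], because moving
    two points by less than [r] does not change distances that are at least
    [r]. *)
From HB Require Import structures.
Require Import Defs.
From mathcomp Require Import all_boot all_order all_algebra.
From mathcomp Require Import all_classical all_reals all_analysis.
From mathcomp Require Import lra.

Import Order.TTheory GRing.Theory Num.Theory.

Local Open Scope classical_set_scope.
Local Open Scope ring_scope.

(** The strong triangle inequality is chained through the moved points in both directions; the short
    sides, below [r <= mdist x y], never decide the maximum. *)
Lemma non_archimedean_dist_eq {R : realType} {Z : metricType R}
    (hZ : non_archimedean Z) {r : R} {x x' y y' : Z} :
  mdist x x' < r -> mdist y y' < r -> r <= mdist x y ->
  mdist x' y' = mdist x y.
Proof.
move=> xx' yy' rxy; apply/eqP; rewrite eq_le; apply/andP; split.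
  have := hZ x' x y'; have := hZ x y y'; rewrite !le_max (metric_sym x' x).
  by move=> /orP[] ? /orP[] ?; lra.
have := hZ x x' y; have := hZ x' y' y; rewrite !le_max (metric_sym y' y).
by move=> /orP[] ? /orP[] ?; lra.
Qed.

Lemma dist_set_lt {R : realType} {X : metricType R} {x : X} {S : set X} {r : R} :
  (dist_set x S < r%:E)%E <-> exists2 s, S s & mdist x s < r.
Proof.
split.
  move=> /ereal_inf_lt[_ [s Ss <-]]; rewrite lte_fin => xs.
  by exists s.
case=> s Ss xs; apply/ereal_inf_ltP; exists (mdist x s)%:E; last first.
  by rewrite lte_fin.
by exists s.
Qed.

Lemma strong_eps_isometry_ge {R : realType} {X Y : metricType R} {eps : R}
    {f : X -> Y} (hf : strong_eps_isometry eps f) (x1 x2 : X) :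
  mdist x1 x2 <= Num.max eps (mdist (f x1) (f x2)).
Proof.
case: hf => _ _ si2; rewrite le_max.
have [->|/eqP/si2/ltW ->//] := eqVneq (mdist x1 x2) (mdist (f x1) (f x2)).
by rewrite lexx orbT.
Qed.

(** Otherwise [SI1] at [x1] and [f x2] gives [z] with [f z] within [eps] of [f x2] and [z] as far
    from [x1] as [f x2] is from [f x1]. By the previous bound [z] is within [eps] of [x2], so the
    triangle [x1], [x2], [z] has a side longer than both others. *)
Lemma strong_eps_isometry_le {R : realType} {X Y : metricType R} {eps : R}
    {f : X -> Y} (hX : non_archimedean X) (hf : strong_eps_isometry eps f)
    (x1 x2 : X) :
  mdist (f x1) (f x2) <= Num.max eps (mdist x1 x2).
Proof.
rewrite leNgt gt_max; apply/negP => /andP[eps_lt x_lt].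
have [_ si1 _] := hf.
have [|z [fz x1z]] := si1 x1 (f x2); first by rewrite metric_sym ltW.
have := strong_eps_isometry_ge hf x2 z; have := hX x1 x2 z.
rewrite x1z (metric_sym (f x2) (f x1)) !le_max.
by move=> /orP[] ? /orP[] ?; lra.
Qed.

Section glue.
Context {R : realType} {X Y : metricType R}.

(** The cutoff at [eps] keeps [x] apart from [f x] and absorbs the error that [f] makes on short
    distances. *)
Definition glue_dist (eps : R) (f : X -> Y) (u v : X + Y) : R :=
  match u, v with
  | inl x1, inl x2 => mdist x1 x2
  | inr y1, inr y2 => mdist y1 y2
  | inl x, inr y | inr y, inl x => Num.max eps (mdist (f x) y)
  end.

Lemma glue_dist_refl eps f u : glue_dist eps f u u = 0.
Proof. by case: u => ?; exact: mdistxx. Qed.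

Lemma glue_dist_sym eps f u v : glue_dist eps f u v = glue_dist eps f v u.
Proof. by case: u v => ? [] ? //=; exact: metric_sym. Qed.

Lemma glue_dist_sep eps f u v :
  0 < eps -> glue_dist eps f u v = 0 -> u = v.
Proof.
move=> e0; case: u v => x [] y /=.
- by move=> /mdist_positivity ->.
- by move=> h; move: e0; rewrite -h gt_max ltxx.
- by move=> h; move: e0; rewrite -h gt_max ltxx.
- by move=> /mdist_positivity ->.
Qed.

(** A triangle with vertices in both spaces has two cross sides, both at least [eps]. Its vertices
    in [X] are sent to [Y] by [f], where [hY] applies; a side inside [X] changes only up to the
    cutoff, by [lef] or [gef]. *)
Lemma glue_dist_ultra eps f u v w :
  non_archimedean X -> non_archimedean Y -> strong_eps_isometry eps f ->
  glue_dist eps f u w <= Num.max (glue_dist eps f u v) (glue_dist eps f v w).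
Proof.
move=> hX hY hf.
have lef := strong_eps_isometry_le hX hf.
have gef := strong_eps_isometry_ge hf.
case: u v w => u [] v [] w /=.
- exact: hX.
- have := lef u v; have := hY (f u) (f v) w.
  rewrite !(le_max, ge_max) lexx /=.
  by move=> /orP[] ? /orP[] ?; lra.
- have := gef u w; have := hY (f u) v (f w).
  rewrite !(le_max, ge_max) (metric_sym v (f w)).
  by move=> /orP[] ? /orP[] ?; lra.
- have := hY (f u) v w.
  rewrite !(le_max, ge_max) lexx /=.
  by move=> /orP[] ?; lra.
- have := lef v w; have := hY (f w) (f v) u.
  rewrite !(le_max, ge_max) lexx /= (metric_sym (f w) (f v)).
  by move=> /orP[] ? /orP[] ?; lra.
- have := hY u (f v) w; rewrite !(le_max, ge_max) (metric_sym u (f v)).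
  by move=> /orP[] ?; lra.
- have := hY (f w) v u; rewrite !(le_max, ge_max) lexx /= (metric_sym v u).
  by move=> /orP[] ?; lra.
- exact: hY.
Qed.

End glue.

Lemma strong_eps_isometry_gromov_hausdorff_le {R : realType}
    {X Y : metricType R} {eps : R} {f : X -> Y} :
  non_archimedean X -> non_archimedean Y -> 0 < eps ->
  strong_eps_isometry eps f -> (na_gromov_hausdorff X Y <= eps%:E)%E.
Proof.
move=> hX hY e0 hf.
pose d := glue_dist eps f.
have d_ultra : forall u v w, d u w <= Num.max (d u v) (d v w).
  by move=> u v w; exact: glue_dist_ultra.
have d_ge0 u v : 0 <= d u v.
  have := d_ultra u v u; rewrite /d glue_dist_refl (glue_dist_sym _ _ v u).
  by rewrite maxxx.
have d_tri v u w : d u w <= d u v + d v w.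
  by rewrite (le_trans (d_ultra u v w))// ge_max lerDl lerDr !d_ge0.
pose Z : metricType R := HB.pack (X + Y)%type (isMetric.Build R (X + Y)%type
  (glue_dist_refl eps f) (fun u v => glue_dist_sep eps f u v e0)
  (glue_dist_sym eps f) d_tri).
apply: (@le_trans _ _ (@hausdorff_dist R Z (range inl) (range inr))).
  apply: ereal_inf_lbound.
  exists Z, inl, inr; split => //; exact: d_ultra.
(* Neighborhoods are strict, while [x] and [f x] are at distance exactly [eps]: hence the slack
   [e]. *)
apply/lee_addgt0Pr => e e_gt0; rewrite -EFinD.
apply: ereal_inf_lbound; exists (eps + e) => //; split.
- exact: addr_gt0.
- move=> _ [x _ <-]; apply/dist_set_lt.
  exists (inr (f x)); first by exists (f x).
  by rewrite /mdist/= mdistxx (max_idPl (ltW e0)) ltrDl.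
- move=> _ [y _ <-]; apply/dist_set_lt.
  have [[_ /(_ y)/dist_set_lt[_ [x _ <-] yfx]] _ _] := hf.
  exists (inl x); first by exists x.
  by rewrite /mdist/= (metric_sym (f x)) (max_idPl (ltW yfx)) ltrDl.
Qed.

Lemma hausdorff_strong_eps_isometry {R : realType} {X Y Z : metricType R}
    {f : X -> Z} {g : Y -> Z} {r eps : R} :
  non_archimedean Z -> isometric f -> isometric g -> r < eps ->
  range f `<=` neighborhood r (range g) ->
  range g `<=` neighborhood r (range f) ->
  exists h : X -> Y, strong_eps_isometry eps h.
Proof.
move=> hZ fI gI r_eps fg gf.
have /choice[h hE] : forall x, exists y, mdist (f x) (g y) < r.
  move=> x; have /dist_set_lt[_ [y _ <-] xy] := fg (f x) (imageT f x).
  by exists y.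
(* The route from [g y] to [g (h x)] through [f x] has two steps below [r]. The same [x] serves the
   net condition and [SI1]. *)
have netP y : exists2 x, mdist (g y) (f x) < r & mdist y (h x) < r.
  have /dist_set_lt[_ [x _ <-] yx] := gf (g y) (imageT g y).
  exists x => //; rewrite -gI; have := hZ (g y) (f x) (g (h x)).
  by have := hE x; rewrite le_max => ? /orP[] ?; lra.
have eq1 x1 x2 : r <= mdist x1 x2 -> mdist (h x1) (h x2) = mdist x1 x2.
  rewrite -fI -gI; exact: (non_archimedean_dist_eq hZ (hE x1) (hE x2)).
have eq2 x1 x2 : r <= mdist (h x1) (h x2) -> mdist (h x1) (h x2) = mdist x1 x2.
  rewrite -fI -gI => le_r; apply/esym; move: le_r.
  by apply: (non_archimedean_dist_eq hZ); rewrite metric_sym.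
exists h; split.
- split.
    (* A supremum of terms below [eps] could reach [eps], so the terms are bounded by [r]. Either
       the two distances agree, or both lie between 0 and [r]. *)
    apply: (@le_lt_trans _ _ r%:E); last by rewrite lte_fin.
    apply: ge_ereal_sup => _ [[x1 x2] _ <-] /=; rewrite lee_fin.
    have r0 : 0 < r by exact: le_lt_trans (mdist_ge0 _ _) (hE x1).
    have [/eq1 ->|xr] := leP r (mdist x1 x2); first by rewrite subrr normr0 ltW.
    have [/eq2 ->|hr] := leP r (mdist (h x1) (h x2)).
      by rewrite subrr normr0 ltW.
    have := mdist_ge0 x1 x2; have := mdist_ge0 (h x1) (h x2) => h0 x0.
    by rewrite ler_norml; apply/andP; split; lra.
  move=> y; apply/dist_set_lt; have [x _ yx] := netP y.
  by exists (h x); [exists x|exact: lt_trans yx r_eps].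
- move=> x y eps_le; have [x' gyfx' yhx'] := netP y.
  exists x'; split; first exact: lt_trans yhx' r_eps.
  (* In [Z], replacing [g y] by [f x'] and [g (h x)] by [f x] moves each point by less than [r]. *)
  rewrite -fI -gI metric_sym.
  apply: (non_archimedean_dist_eq hZ (r := r) gyfx').
    by rewrite metric_sym hE.
  by rewrite gI; exact: le_trans (ltW r_eps) eps_le.
- move=> x1 x2 neq; apply: lt_trans r_eps; rewrite ltNge.
  by apply/negP => /eq1 e; apply: neq.
Qed.

Theorem corollary2p24 (R : realType) (X Y : metricType R)
    (hX : non_archimedean X) (hY : non_archimedean Y) :
  na_gromov_hausdorff X Y =
  ereal_inf [set eps%:E | eps in
    [set eps : R | 0 < eps /\ exists f : X -> Y, strong_eps_isometry eps f]].
Proof.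
apply/eqP; rewrite eq_le; apply/andP; split.
  apply: le_ereal_inf_tmp => _ [eps [e0 [f hf]] <-].
  exact: strong_eps_isometry_gromov_hausdorff_le hX hY e0 hf.
apply: le_ereal_inf_tmp => _ [Z [f [g [hZ fI gI ->]]]].
apply: le_ereal_inf_tmp => _ [r [r0 fg gf] <-].
(* An admissible radius [r] yields strong isometries for every parameter above [r], which suffices
   for the infimum. *)
apply/lee_addgt0Pr => e e0; rewrite -EFinD.
have r_lt : r < r + e by rewrite ltrDl.
apply: ereal_inf_lbound; exists (r + e) => //; split; first exact: addr_gt0.
exact: hausdorff_strong_eps_isometry hZ fI gI r_lt fg gf.
Qed.
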